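(* Let $$f(\gamma)=(\gamma^3-3\gamma^2+6\gamma-6)^2-72\gamma(2-\gamma)(\gamma-1)^2,$$ and let $\lambda_0=1.97466\dots$ be the solution of the equation $f(\gamma)=0$ such that $f(\gamma)>0$ whenever $\gamma\in(\lambda_0,2)$. Then for every positive integer $n$, $$R(P^3_3;n)\le \lambda_0 n+7\sqrt{n}.$$
   Context: $P^3_3$ denotes the 3-uniform hypergraph (the 3-path of length three) with vertex set $\{a,b,c,d,e,f,g\}$ (seven distinct vertices) and edge set $\{\{a,b,c\},\{c,d,e\},\{e,f,g\}\}$. $K^3_N$ denotes the complete 3-uniform hypergraph on $N$ vertices. The Ramsey number $R(P^3_3;n)$ is the smallest integer $N$ such that every coloring of the edges of $K^3_N$ with $n$ colors contains a monochromatic copy of $P^3_3$ (a not necessarily induced subhypergraph isomorphic to $P^3_3$, all of whose edges have the same color). *)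

(* Defs.v *)
From mathcomp Require Import all_boot all_order all_algebra.
From mathcomp Require Import reals.

Set Implicit Arguments.
Unset Strict Implicit.
Unset Printing Implicit Defensive.

Import Order.TTheory GRing.Theory Num.Theory.
Local Open Scope ring_scope.

(* A hypergraph on a vertex type [T] is given by its edge set in [{set {set T}}];
   copies are not required to be induced. *)
Definition contains_copy (U T : finType) (H : {set {set U}})
    (G : {set {set T}}) : bool :=
  [exists phi : {ffun U -> T},
     injectiveb phi && [forall e in H, phi @: e \in G]].

Definition complete3 (T : finType) : {set {set T}} :=
  [set e : {set T} | #|e| == 3%N].

(* The vertices a, ..., g are numbered 0, ..., 6. *)
Definition path3_3 : {set {set 'I_7}} :=
  [set [set inord 0; inord 1; inord 2];
       [set inord 2; inord 3; inord 4];
       [set inord 4; inord 5; inord 6]].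

(* A coloring is represented by a function on all subsets of the vertex set; only
   its values on the 3-element subsets are used, so for n > 0 this is the same as
   coloring the edges of the complete 3-uniform hypergraph. *)
Definition color_class (T : finType) (n : nat) (c : {ffun {set T} -> 'I_n})
    (k : 'I_n) : {set {set T}} :=
  [set e in complete3 T | c e == k].

Definition ramsey_arrow (n N : nat) : bool :=
  [forall c : {ffun {set 'I_N} -> 'I_n},
     [exists k, contains_copy path3_3 (color_class c k)]].

(* In an n-edge-coloring of the complete bipartite graph with parts
   ['I_n.+1] and ['I_M], where M > (n+1)^2 n, there is a monochromatic path
   i - x - j - y.  Adding to each graph edge a vertex of its own turns such a
   path into a copy of [path3_3]. *)
Lemma bipartite_mono_path (n : nat) (M := ((n.+1 * n.+1) * n).+1)
    (d : 'I_n.+1 -> 'I_M -> 'I_n) :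
  exists i j x y, [/\ i != j, x != y, d i x = d j x & d j x = d j y].
Proof.
have pair x : exists p : 'I_n.+1 * 'I_n.+1,
    (p.1 != p.2) && (d p.1 x == d p.2 x).
  have /injectivePn[i [j ij eij]] : ~~ injectiveb (d ^~ x).
    apply/negP => /injectiveP /leq_card.
    by rewrite !card_ord ltnn.
  by exists (i, j); rewrite /= ij eij eqxx.
pose p x := xchoose (pair x).
pose g x := (p x, d (p x).2 x).
have /injectivePn[x [y xy exy]] : ~~ injectiveb g.
  apply/negP => /injectiveP /leq_card.
  by rewrite !card_prod !card_ord ltnn.
have epx : p x = p y by apply: (congr1 fst exy).
have edx : d (p x).2 x = d (p y).2 y by apply: (congr1 snd exy).
have /andP[pij /eqP dpx] := xchooseP (pair x).
exists (p x).1, (p x).2, x, y; split => //.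
by rewrite edx epx.
Qed.

Lemma ramsey_arrow_ex (n : nat) : exists N, ramsey_arrow n N.
Proof.
pose M := ((n.+1 * n.+1) * n).+1.
pose T := ('I_n.+1 + 'I_M + 'I_n.+1 * 'I_M)%type.
exists #|{: T}|; apply/forallP => c.
pose L (i : 'I_n.+1) : 'I_#|{: T}| := enum_rank (inl (inl i) : T).
pose X (x : 'I_M) : 'I_#|{: T}| := enum_rank (inl (inr x) : T).
pose E i x : 'I_#|{: T}| := enum_rank (inr (i, x) : T).
pose edge i x := [set L i; E i x; X x].
have edge3 i x : #|edge i x| == 3%N.
  by rewrite /edge -setUA cardsU1 cards2 !inE !(inj_eq enum_rank_inj).
have [i [j [x [y [ij xy e1 e2]]]]] :=
  bipartite_mono_path (fun i x => c (edge i x)).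
pose s := [:: L i; E i x; X x; E j x; L j; E j y; X y].
have us : uniq s.
  rewrite /= !inE !(inj_eq enum_rank_inj) /=.
  have Eij (a b : 'I_n.+1) (u v : 'I_M) : (a != b) || (u != v) ->
      ((inr (a, u) : T) == inr (b, v)) = false.
    by move=> h; apply/eqP => -[eab euv]; move: h; rewrite eab euv !eqxx.
  rewrite !Eij ?ij ?xy ?orbT //=.
  rewrite andbT; apply/norP; split; last by apply/eqP.
  by apply/eqP => -[eij]; rewrite eij eqxx in ij.
apply/existsP; exists (c (edge i x)).
apply/existsP; exists [ffun a : 'I_7 => nth (L i) s a].
apply/andP; split.
  apply/injectiveP => a b; rewrite !ffunE => /eqP.
  by rewrite nth_uniq ?ltn_ord // => /eqP/val_inj.
apply/forall_inP => e; rewrite !inE -orbA => /or3P[] /eqP->;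
  rewrite !(imsetU, imset_set1) !ffunE !inordK //=.
- by rewrite edge3 eqxx.
- have -> : [set X x; E j x; L j] = edge j x.
    by rewrite /edge setUC setUA [in RHS]setUAC.
  by rewrite edge3 e1 eqxx.
- by rewrite edge3 e1 e2 eqxx.
Qed.

Definition ramsey_path3_3 (n : nat) : nat := ex_minn (ramsey_arrow_ex n).

Definition lambda_fun (R : realType) (g : R) : R :=
  (g ^+ 3 - 3 * g ^+ 2 + 6 * g - 6) ^+ 2
  - 72 * g * (2 - g) * (g - 1) ^+ 2.

(* [lambda_fun] is positive on [2, +oo) as well, so l < 2 is only there to exclude the vacuous case
   of an empty interval (l, 2) explicitly. *)
Definition is_lambda0 (R : realType) (l : R) : Prop :=
  [/\ l < 2, lambda_fun l = 0 & forall g, l < g < 2 -> 0 < lambda_fun g].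

(* Main.v *)
Require Import Defs.
From mathcomp Require Import all_boot all_order all_algebra.
From mathcomp Require Import reals.
From mathcomp Require Import zify ring lra.

Set Implicit Arguments.
Unset Strict Implicit.
Unset Printing Implicit Defensive.

Import Order.TTheory GRing.Theory Num.Theory.
Local Open Scope ring_scope.

(** The constant [lambda0] is located by monotonicity of [lambda_fun] near [2];
    the Ramsey bound only needs [lambda0 >= 1.97], and holds because of a
    structure theorem for hypergraphs without a path of length three.

    Let [H] be such a 3-graph. Deleting vertices of degree at most 16 one by
    one costs at most 16 edges per vertex and leaves a 3-graph [G] with all
    degrees at least 17. In [G], every edge has at least two vertices [x]
    that are leaves: some other vertex, the centre of [x], lies on all the
    edges at [x]. ([no_two_fat], the main combinatorial lemma: a pair of
    vertices in five common edges always contains a leaf centred at the other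
    one, and with large degrees this excludes edges with two non-leaves.) So
    each edge of [G] is either a star edge, two leaves and their common centre,
    or contains two leaves that are each other's centre.

    Given a colouring of the triples of [N] points with [n] colours and no
    monochromatic path, draw an arc from the centre of [x] to [x] for every
    colour in which [x] is a leaf. Then every in-degree is at most [n], and:
    - two vertices [x], [y] not joined by an arc lie, in each colour, on at
      most one edge of [G], as the third vertex must be the centre of [x] or
      of [y]; at least [N - 2 - n] triples on [x] and [y] are therefore among
      the deleted edges, so there are few such pairs;
    - an edge of [G] whose three pairs are all joined contains a vertex with
      two in-arcs from the other two, for the three arcs do not form a cycle.
    The second kind of triples is at most the sum of [C(indegree, 2)], about
    [N n^2 / 2], and the other triples are few, so [N^3 / 6 <= N n^2 / 2] up to
    lower order terms, that is [N <= sqrt 3 n + O(1)]. A vertex that is deleted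
    in some colour is not a leaf there, so that the deleted triples are partly
    paid for by smaller in-degrees; this makes the error terms small enough for
    all [n >= 25] ([oriented_count]). For [n < 25] it is enough to bound the size
    of a colour class by about [N^2 / 2], or linearly for small [N]
    ([path_free_card]). *)

(** * Hypergraphs without a path of length three *)

Section PathFree.
Local Open Scope nat_scope.

Variable V : finType.
Implicit Types (H G : {set {set V}}) (x y z : V) (e : {set V}).

Definition uniform3 H := forall e, e \in H -> #|e| = 3.

Definition path_free H := forall a b c d e f g : V,
  [set a; b; c] \in H -> [set c; d; e] \in H -> [set e; f; g] \in H ->
  ~~ uniq [:: a; b; c; d; e; f; g].

Definition edges_at H x := [set e in H | x \in e].

Definition edges_at2 H x y := [set e in H | (x \in e) && (y \in e)].

(** The link of [x] is a star with centre [v]; this includes isolated [x]. *)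
Definition thin H x v := (v != x) && [forall e in edges_at H x, v \in e].

Definition fat H x := [forall v, ~~ thin H x v].

Lemma uniform3_sub H G : G \subset H -> uniform3 H -> uniform3 G.
Proof. by move=> /subsetP sGH H3 e /sGH /H3. Qed.

Lemma path_free_sub H G : G \subset H -> path_free H -> path_free G.
Proof.
by move=> /subsetP sGH pfH a b c d e f g ? ? ?; apply: pfH; apply: sGH.
Qed.

Section Structure.

Variable H : {set {set V}}.
Hypotheses (H3 : uniform3 H) (pfH : path_free H).

Local Notation E a b c := ([set a; b; c] \in H).

Lemma edge_swap a b c : E a b c -> E b a c.
Proof. by rewrite [ [set b; a] ]setUC. Qed.

Lemma edge_rot a b c : E a b c -> E b c a.
Proof. by rewrite -setUA setUC. Qed.

Lemma edge_neq a b c : E a b c -> [/\ a != b, a != c & b != c].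
Proof.
move/H3; rewrite cardsU cards2 cards1 => card_e.
have: #|[set a; b] :&: [set c]| = 0 /\ a != b.
  by move: card_e; case: (a != b) => /=; lia.
case=> /eqP; rewrite cards_eq0 setI_eq0 disjoint_sym disjoints1.
by rewrite !inE negb_or ![_ == c]eq_sym => /andP[].
Qed.

Lemma edge_at_shape x e : e \in H -> x \in e ->
  exists a b, e = [set x; a; b].
Proof.
move=> eH xe; have /cards2P[a [b [_ ab]]] : #|e :\ x| == 2.
  by rewrite -(eqn_add2l (x \in e)) -cardsD1 xe H3.
exists a, b.
by rewrite -(setD1K xe) ab setUA.
Qed.

Lemma edge_at2_shape x y e : e \in H -> x != y -> x \in e -> y \in e ->
  exists a, e = [set x; y; a].
Proof.
move=> eH xy /(edge_at_shape eH)[a [b ->]].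
rewrite !inE eq_sym (negPf xy) => /orP[] /eqP ->; first by exists b.
by exists a; rewrite setUAC.
Qed.

Lemma thinP x v a b : thin H x v -> E x a b -> v = a \/ v = b.
Proof.
case/andP=> vx /forall_inP hv Exab.
have := hv [set x; a; b]; rewrite !inE Exab eqxx (negPf vx) => /(_ isT).
by case/orP => /eqP ->; [left | right].
Qed.

Lemma not_thinP x v : v != x -> ~~ thin H x v ->
  exists a b, [/\ E x a b, v != a & v != b].
Proof.
rewrite /thin => -> /= /forall_inPn[e]; rewrite inE => /andP[eH xe].
have [a [b def_e]] := edge_at_shape eH xe; rewrite {}def_e in eH *.
by rewrite !inE !negb_or -andbA => /and3P[_ va vb]; exists a, b.
Qed.

Lemma fatP x v : fat H x -> v != x -> exists a b, [/\ E x a b, v != a & v != b].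
Proof. by move/forallP=> fx vx; apply: not_thinP. Qed.

Lemma fat_not_thin x v : fat H x -> ~ thin H x v.
Proof. by move/forallP/(_ v)/negP. Qed.

(** A pair in more than [size s] edges has an extension outside of [s]; this is
    how codegrees are used to keep the vertices of a path distinct. *)
Lemma pick_codegree x y (s : seq V) : x != y -> size s < #|edges_at2 H x y| ->
  exists2 w, w \notin s & E x y w.
Proof.
move=> xy; have [/existsP[w /andP[ws Ew]] _ | none] :=
  boolP [exists w, (w \notin s) && E x y w]; first by exists w.
rewrite ltnNge => /negP[]; apply: leq_trans (card_size s).
apply: leq_trans (leq_imset_card (fun w => [set x; y; w]) (mem s)).
apply: subset_leq_card; apply/subsetP=> e; rewrite inE => /and3P[eH xe ye].
have [w def_e] := edge_at2_shape eH xy xe ye; rewrite {}def_e in eH *.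
apply: imset_f; apply: contraNT none => ws.
by apply/existsP; exists w; rewrite ws.
Qed.

(** Degrees are bounded by a list [t] of exceptional edges and a list [s] of
    vertices that covers the other edges at [x]. *)
Lemma degree_cover x (t : seq {set V}) (s : seq V) :
  (forall e, e \in H -> x \in e -> (e \in t) || has (mem e) s) ->
  #|edges_at H x| <= size t + \sum_(u <- s) #|edges_at2 H x u|.
Proof.
move=> cov; have {cov} : forall e, e \in edges_at H x -> (e \in t) || has (mem e) s.
  by move=> e; rewrite inE => /andP[]; apply: cov.
have : edges_at H x \subset edges_at H x by [].
move: {1 3 4}(edges_at H x) => A; elim: s A => [|u s IHs] A sA cov.
  rewrite big_nil addn0; apply: leq_trans (card_size t).
  by apply/subset_leq_card/subsetP => e /cov; rewrite orbF.
rewrite big_cons addnCA -(cardsID [set e : {set V} | u \in e] A) leq_add //.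
  apply/subset_leq_card/subsetP => e; rewrite !inE => /andP[/(subsetP sA)].
  by rewrite inE => /andP[-> ->] ->.
apply: IHs => [|e]; first by apply: subset_trans sA; apply: subsetDl.
by rewrite !inE => /andP[ue /cov] /=; rewrite (negPf ue).
Qed.

(** Of the 21 disequalities between the vertices of a path, 9 come from its three
    edges; [by_neqs] finds these, and reads the others off the context. *)
Ltac by_perm := first [ assumption
  | apply: edge_swap; assumption
  | apply: edge_rot; assumption
  | apply: edge_rot; apply: edge_rot; assumption
  | apply: edge_swap; apply: edge_rot; assumption
  | apply: edge_swap; apply: edge_rot; apply: edge_rot; assumption ].

Ltac edge_facts := repeat match goal with
  | h : is_true ([set _; _; _] \in _) |- _ =>
      have [? ? ?] := edge_neq h; revert h
  end; intros.

Ltac split_neqs := repeat match goal with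
  | h : is_true (_ \notin _) |- _ => rewrite !inE ?negb_or in h
  | h : is_true (_ && _) |- _ => case/andP: h => ? ?
  end.

Ltac by_neqs := split_neqs; edge_facts; rewrite /= ?inE ?negb_or;
  repeat (apply/andP; split); solve [ by [] | assumption | rewrite eq_sym; assumption ].

Ltac path7 a b c d e f g :=
  have : ~~ uniq [:: a; b; c; d; e; f; g] by apply: pfH; by_perm.

(** 17 is [4 * 4 + 1]: if four vertices meet all the edges at [x], then one of
    them has codegree at least 5 with [x]. *)
Hypothesis deg_gt16 : forall x e, e \in H -> x \in e -> 16 < #|edges_at H x|.

(** The forbidden path is [x q w], [w t u], [u t' w'], for suitable [t], [t']. *)
Lemma no_two_books x q w w' u : E x q w -> E x q w' -> w != w' ->
  u != x -> u != q -> w != u -> w' != u ->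
  3 < #|edges_at2 H w u| -> 4 < #|edges_at2 H w' u| -> False.
Proof.
move=> E1 E2 ww' ux uq wu w'u h3 h4.
have [t t_new E3] := @pick_codegree w u [:: x; q; w'] wu h3.
have [t' t'_new E4] := @pick_codegree w' u [:: x; q; w; t] w'u h4.
by path7 x q w t u t' w'; case/negP; by_neqs.
Qed.

(** Edges [x v a], [q v b] whose links at [x] and [q] meet in [v]. By
    path-freeness an edge at a further extension [w] of the pair [x q] must, up
    to three exceptions, contain [v] or both of [a] and [b]. Degree 17 then
    makes [v] (or, when [a = b], one of [v] and [a]) the partner of two
    different [w] with large codegree, against [no_two_books]. *)
Lemma no_crossing_pair x q v a b : x != q -> E x v a -> E q v b -> q != a -> x != b ->
  4 < #|edges_at2 H x q| -> False.
Proof.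
move=> xq Ex Eq qa xb heavy.
have generic w : E x q w -> w \notin [:: v; a; b] -> forall e, e \in H -> w \in e ->
    [|| e == [set w; x; q], e == [set w; x; b], e == [set w; q; a], v \in e
      | (a \in e) && (b \in e)].
  move=> Ew w_new e eH we; apply: contraT; rewrite !negb_or.
  case/and5P=> e1 e2 e3 ve abe.
  have qcase t : E w x t -> v != t -> t != q -> t != b -> False.
    move=> Et vt tq tb.
    have [w' w'_new Ew'] := @pick_codegree x q [:: w; t; v; b] xq heavy.
    by path7 w t x w' q v b; case/negP; by_neqs.
  have xcase t : E w q t -> v != t -> t != x -> t != a -> False.
    move=> Et vt tx ta.
    have [w' w'_new Ew'] := @pick_codegree x q [:: w; t; v; a] xq heavy.
    by path7 w t q w' x v a; case/negP; by_neqs.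
  have [xe|xe] := boolP (x \in e).
    have wx : w != x by have [_ + _] := edge_neq Ew; rewrite eq_sym.
    have [t def_e] := edge_at2_shape eH wx we xe; rewrite {}def_e in eH e1 e2 ve.
    case: (qcase t) => //; first by move: ve; rewrite !inE !negb_or => /andP[].
      by apply: contraNneq e1 => ->.
    by apply: contraNneq e2 => ->.
  have [qe|qe] := boolP (q \in e).
    have wq : w != q by have [_ _ +] := edge_neq Ew; rewrite eq_sym.
    have [t def_e] := edge_at2_shape eH wq we qe; rewrite {}def_e in eH e1 e3 ve xe.
    case: (xcase t) => //; first by move: ve; rewrite !inE !negb_or => /andP[].
      by apply: contraNneq xe => <-; rewrite !inE eqxx orbT.
    by apply: contraNneq e3 => ->.
  have [s [t def_e]] := edge_at_shape eH we; rewrite {}def_e in eH ve abe xe qe.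
  have ae : a \in [set w; s; t].
    apply: contraT => ae.
    by path7 s t w q x v a; case/negP; by_neqs.
  have be : b \in [set w; s; t].
    apply: contraT => be.
    by path7 s t w x q v b; case/negP; by_neqs.
  by rewrite ae be in abe.
have [ab|ab] := eqVneq a b; last first.
  have book w : E x q w -> w \notin [:: v; a; b] -> 12 < #|edges_at2 H w v|.
    move=> Ew w_new; have wE : w \in [set x; q; w] by rewrite !inE eqxx !orbT.
    have := @degree_cover w [:: [set w; x; q]; [set w; x; b]; [set w; q; a]; [set w; a; b]] [:: v].
    rewrite big_cons big_nil addn0 /=.
    have := deg_gt16 Ew wE => + cov; move/leq_trans/(_ (cov _)); rewrite !ltnS; apply.
    move=> e eH we; have := generic w Ew w_new e eH we.
    rewrite !inE /=; case/or4P=> [->|->|->|/orP[->|/andP[ae be]]]; rewrite ?orbT //.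
    have wa : w != a by by_neqs.
    have [t def_e] := edge_at2_shape eH wa we ae; rewrite def_e in be *.
    suff -> : t = b by rewrite eqxx !orbT.
    move: be; rewrite !inE [b == a]eq_sym (negPf ab) => /orP[/orP[]//|/eqP->//].
    by move=> /eqP bw; move: w_new; rewrite !inE bw eqxx !orbT.
  have [w1 w1_new E1] := @pick_codegree x q [:: v; a; b] xq (ltnW heavy).
  have [w2 w2_new E2] := @pick_codegree x q [:: v; a; b; w1] xq heavy.
  apply: (@no_two_books x q w1 w2 v) => //; try by_neqs.
    by apply: leq_trans (book _ E1 w1_new).
  by apply: leq_trans (book _ E2 _) => //; by_neqs.
subst b.
have book w : E x q w -> w \notin [:: v; a] ->
    (5 < #|edges_at2 H w v|) || (5 < #|edges_at2 H w a|).
  move=> Ew w_new; have wE : w \in [set x; q; w] by rewrite !inE eqxx !orbT.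
  have := @degree_cover w [:: [set w; x; q]] [:: v; a].
  rewrite !big_cons big_nil addn0 /=.
  have := deg_gt16 Ew wE => + cov; move/leq_trans/(_ (cov _)) => H1.
  suff : 16 < 1 + (#|edges_at2 H w v| + #|edges_at2 H w a|).
    move: #|edges_at2 H w v| #|edges_at2 H w a| => p r; clear; lia.
  apply: H1 => e eH we; have := generic w Ew _ e eH we.
  have -> : w \notin [:: v; a; a] by by_neqs.
  move/(_ isT); rewrite !inE /= orbF.
  by case/or4P=> [->|/eqP->|/eqP->|/orP[->|/andP[-> _]]]; rewrite ?inE ?eqxx ?orbT.
have [w1 w1_new E1] := @pick_codegree x q [:: v; a] xq (ltnW (ltnW heavy)).
have [w2 w2_new E2] := @pick_codegree x q [:: v; a; w1] xq (ltnW heavy).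
have [w3 w3_new E3] := @pick_codegree x q [:: v; a; w1; w2] xq heavy.
have n2 : w2 \notin [:: v; a] by by_neqs.
have n3 : w3 \notin [:: v; a] by by_neqs.
have two w w' u : E x q w -> E x q w' -> w != w' -> u \in [:: v; a] ->
   w \notin [:: v; a] -> w' \notin [:: v; a] ->
   5 < #|edges_at2 H w u| -> 5 < #|edges_at2 H w' u| -> False.
  move=> Ew Ew' ww' u_in w_new w'_new c c'.
  apply: (@no_two_books x q w w' u) => //; try (by apply: leq_trans c);
    try (by apply: leq_trans c'); move: u_in; rewrite !inE => /orP[] /eqP ->; by_neqs.
have w12 : w1 != w2 by by_neqs.
have w13 : w1 != w3 by by_neqs.
have w23 : w2 != w3 by by_neqs.
have vin : v \in [:: v; a] by rewrite inE eqxx.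
have ain : a \in [:: v; a] by rewrite !inE eqxx orbT.
case/orP: (book _ E1 w1_new) => c1; case/orP: (book _ E2 n2) => c2;
  case/orP: (book _ E3 n3) => c3.
- exact: (two w1 w2 v).
- exact: (two w1 w2 v).
- exact: (two w1 w3 v).
- exact: (two w2 w3 a).
- exact: (two w2 w3 v).
- exact: (two w1 w3 a).
- exact: (two w1 w2 a).
- exact: (two w1 w2 a).
Qed.

(** Call a pair of codegree at least 5 heavy. If the conclusion fails, there are
    edges [x a b] avoiding [q] and [q c d] avoiding [x]: either they are disjoint,
    and form a path with an edge through [x] and [q], or they share a vertex, as
    in [no_crossing_pair]. *)
Lemma heavy_thin x q : x != q -> 4 < #|edges_at2 H x q| -> thin H x q \/ thin H q x.
Proof.
move=> xq heavy; have qx : q != x by rewrite eq_sym.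
have [_|/(not_thinP qx)[a [b [Ex qa qb]]]] := boolP (thin H x q); first by left.
have [_|/(not_thinP xq)[c [d [Eq xc xd]]]] := boolP (thin H q x); first by right.
exfalso; have [ac|ac] := eqVneq a c.
  by subst c; apply: (no_crossing_pair xq Ex Eq).
have [ad|ad] := eqVneq a d.
  by subst d; apply: (@no_crossing_pair x q a b c) => //; by_perm.
have [bc|bc] := eqVneq b c.
  by subst c; apply: (@no_crossing_pair x q b a d) => //; by_perm.
have [bd|bd] := eqVneq b d.
  by subst d; apply: (@no_crossing_pair x q b a c) => //; by_perm.
have [w w_new Ew] := @pick_codegree x q [:: a; b; c; d] xq heavy.
by path7 a b x w q c d; case/negP; by_neqs.
Qed.

Lemma fat_heavy x u : fat H x -> x != u -> 4 < #|edges_at2 H x u| -> thin H u x.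
Proof.
by move=> fx xu /(heavy_thin xu)[] // /(fat_not_thin fx).
Qed.

Lemma fat_codegree x y : fat H x -> fat H y -> x != y -> #|edges_at2 H x y| <= 4.
Proof.
move=> fx fy xy; rewrite leqNgt; apply/negP => /(fat_heavy fx xy).
exact: fat_not_thin.
Qed.

Lemma mem_edge3 (a b c : V) : [/\ a \in [set a; b; c], b \in [set a; b; c] & c \in [set a; b; c]].
Proof. by rewrite !inE !eqxx !orbT. Qed.

(** For an edge [x y z]: some edge meets it in [y] only. *)
Definition private_edge x y z := [exists s, exists t,
  [&& E y s t, s \notin [:: x; z] & t \notin [:: x; z]]].

Lemma private_edgeP x y z : reflect
  (exists s t, [/\ E y s t, s \notin [:: x; z] & t \notin [:: x; z]]) (private_edge x y z).
Proof.
apply: (iffP existsP) => [[s /existsP[t /and3P[? ? ?]]]|[s [t [? ? ?]]]].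
  by exists s, t.
by exists s; apply/existsP; exists t; apply/and3P.
Qed.

(** All edges at [x] meet [y], [z], [s] or [t], since the others would form a
    path with [x y z] and [y s t]; one of these four is heavy with [x], and it is
    not [y], which is fat. *)
Lemma fat_heavy_neighbour x y z s t : E x y z -> fat H x -> fat H y ->
  E y s t -> s \notin [:: x; z] -> t \notin [:: x; z] ->
  exists2 u, u \in [:: z; s; t] & thin H u x /\ 4 < #|edges_at2 H x u|.
Proof.
move=> Exyz fx fy Eyst s_new t_new.
have [/hasP[u u_in heavy]|light] := boolP (has (fun u => 4 < #|edges_at2 H x u|) [:: z; s; t]).
  exists u => //; split => //; apply: fat_heavy => //.
  by move: u_in; rewrite !inE => /or3P[] /eqP ->; by_neqs.
have xy : x != y by by_neqs.
have [xE _ _] := mem_edge3 x y z.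
have := @degree_cover x [::] [:: y; z; s; t].
have := deg_gt16 Exyz xE => + cov; move/leq_trans/(_ (cov _)) => {cov} H1.
suff : 16 < size ([::] : seq {set V}) + \sum_(u <- [:: y; z; s; t]) #|edges_at2 H x u|.
  rewrite !big_cons big_nil /=; move: light; rewrite /= !negb_or -!leqNgt => /and4P[].
  have := fat_codegree fx fy xy.
  move: #|edges_at2 H x y| #|edges_at2 H x z| #|edges_at2 H x s| #|edges_at2 H x t|.
  by clear; lia.
apply: H1 => e eH xe; apply: contraT; rewrite /= !negb_or andbT => /and4P[ye ze se te].
have [a [b def_e]] := edge_at_shape eH xe; rewrite {}def_e in eH ye ze se te.
by path7 a b x z y s t; case/negP; by_neqs.
Qed.

(** The vertices [x] and [z] cover all edges at [y], and [x] is fat. *)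
Lemma no_private_edge x y z : E x y z -> fat H x -> fat H y -> ~~ private_edge x y z ->
  thin H z y /\ 12 < #|edges_at2 H y z|.
Proof.
move=> Exyz fx fy noP.
suff h : 12 < #|edges_at2 H y z|.
  by split=> //; apply: fat_heavy => //; [by_neqs | apply: leq_trans h].
have [_ yE _] := mem_edge3 x y z.
have yx : y != x by by_neqs.
have := @degree_cover y [::] [:: x; z].
have := deg_gt16 Exyz yE => + cov; move/leq_trans/(_ (cov _)) => {cov} H1.
suff : 16 < size ([::] : seq {set V}) + \sum_(u <- [:: x; z]) #|edges_at2 H y u|.
  rewrite !big_cons big_nil /=; have := fat_codegree fy fx yx.
  move: #|edges_at2 H y x| #|edges_at2 H y z|.
  by clear; lia.
apply: H1 => e eH ye; apply: contraR noP; rewrite /= orbF negb_or => /andP[xe ze].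
have [a [b def_e]] := edge_at_shape eH ye; rewrite {}def_e in eH ye ze xe.
by apply/private_edgeP; exists a, b; split; by_neqs.
Qed.

(** The heavy neighbour of [x] can only be [z], since a vertex of the edge
    [y s t], which avoids [x], is not thin with centre [x]. *)
Lemma private_edge_thin x y z : E x y z -> fat H x -> fat H y -> private_edge x y z ->
  thin H z x /\ 4 < #|edges_at2 H x z|.
Proof.
move=> Exyz fx fy /private_edgeP[s [t [Eyst s_new t_new]]].
have [u] := fat_heavy_neighbour Exyz fx fy Eyst s_new t_new.
rewrite !inE => /or3P[]/eqP-> // [/thinP tu _]; exfalso.
  have [xy|xt] : x = y \/ x = t by apply: tu; by_perm.
    by have : x != y by [by_neqs]; rewrite xy eqxx.
  by move: t_new; rewrite xt !inE eqxx.
have [xy|xs] : x = y \/ x = s by apply: tu; by_perm.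
  by have : x != y by [by_neqs]; rewrite xy eqxx.
by move: s_new; rewrite xs !inE eqxx.
Qed.

Lemma thin_thin_light x y z : E x y z -> thin H z x -> thin H z y ->
  4 < #|edges_at2 H x z| -> False.
Proof.
move=> Exyz tx ty heavy.
have xz : x != z by by_neqs.
have [w w_new Ew] := @pick_codegree x z [:: y] xz (ltnW (ltnW (ltnW heavy))).
have [yx|yw] : y = x \/ y = w by apply: (thinP ty); by_perm.
  by have : x != y by [by_neqs]; rewrite yx eqxx.
by move: w_new; rewrite yw !inE eqxx.
Qed.

(** Here [z] is thin with centre [y]. Take an edge [x y w'] with [w' != z]. Path
    [z w y], [y w' x], [x s t] shows that every edge [x s t] avoiding [y] contains
    [w'], so that [w'] is thin with centre [x]. Then the vertex [t] of such an edge
    [x w' t] has degree at most 2: it is on no other edge through [x], and an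
    edge at [t] avoiding [x] and different from [y z t] would form a path with
    [t w' x], [x y z]. *)
Lemma private_one_side x y z : E x y z -> fat H x -> fat H y ->
  private_edge y x z -> ~~ private_edge x y z -> False.
Proof.
move=> Exyz fx fy pX nopY.
have [tz heavy] := no_private_edge Exyz fx fy nopY.
have at_y s t : E y s t -> (x \in [:: s; t]) || (z \in [:: s; t]).
  move=> Eyst; apply: contraR nopY; rewrite !inE !negb_or => /andP[/andP[? ?] /andP[? ?]].
  by apply/private_edgeP; exists s, t; split => //; by_neqs.
have z_free s t : E x s t -> y != s -> y != t -> z \notin [:: s; t].
  move=> Exst ys yt; have xy : y != x by by_neqs.
  rewrite !inE; apply/norP; split; apply/eqP => def_z; subst z.
    by case: (@thinP s y x t tz) => [|yx|yx]; [by_perm | move: xy | move: yt];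
      rewrite yx eqxx.
  by case: (@thinP t y x s tz) => [|yx|yx]; [by_perm | move: xy | move: ys];
    rewrite yx eqxx.
have key w' s t : E x y w' -> w' != z -> E x s t -> y != s -> y != t -> w' \in [:: s; t].
  move=> Ew' w'z Exst ys yt; apply: contraT => w'_new.
  have z_new := z_free s t Exst ys yt.
  have yz : y != z by by_neqs.
  have heavy4 : 4 < #|edges_at2 H y z| by apply: leq_trans heavy.
  have [w w_new Ew] := @pick_codegree y z [:: x; w'; s; t] yz heavy4.
  by path7 z w y w' x s t; case/negP; by_neqs.
have [w' w'z Ew'] : exists2 w', w' != z & E x y w'.
  have [] := @fatP y z fy; first by by_neqs.
  move=> a [b [Eab za zb]]; have := at_y a b Eab.
  rewrite !inE (negPf za) (negPf zb) /= orbF => /orP[] /eqP def_x; subst x.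
    by exists b; [by_neqs | by_perm].
  by exists a; [by_neqs | by_perm].
have xy : x != y by by_neqs.
have xw' : x != w' by by_neqs.
have heavy' : 12 < #|edges_at2 H x w'|.
  have [xE _ _] := mem_edge3 x y z.
  have := @degree_cover x [::] [:: y; w'].
  have := deg_gt16 Exyz xE => + cov; move/leq_trans/(_ (cov _)) => {cov} H1.
  suff : 16 < size ([::] : seq {set V}) + \sum_(u <- [:: y; w']) #|edges_at2 H x u|.
    rewrite !big_cons big_nil /=; have := fat_codegree fx fy xy.
    move: #|edges_at2 H x y| #|edges_at2 H x w'|.
    by clear; lia.
  apply: H1 => e eH xe; rewrite /= orbF; case: (boolP (y \in e)) => //= ye.
  have [s [t def_e]] := edge_at_shape eH xe; rewrite {}def_e in eH ye *.
  move: ye; rewrite !inE !negb_or => /andP[/andP[_ ys] yt].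
  by have := key w' s t Ew' w'z eH ys yt; rewrite !inE -orbA => ->; rewrite orbT.
have tw' : thin H w' x by apply: fat_heavy => //; apply: leq_trans heavy'.
have [t t_new Et] : exists2 t, t \notin [:: y; z] & E x w' t.
  case/private_edgeP: pX => s [t [Exst s_new t_new]].
  have := key w' s t Ew' w'z Exst; rewrite !inE => /(_ _ _)/orP[]; try by by_neqs.
    by move/eqP=> def_s; subst s; exists t.
  by move/eqP=> def_t; subst t; exists s => //; by_perm.
(* Otherwise [t] could play the role of [w'], and all edges [x w' r] avoiding
   [y] would contain [t]. *)
have not_yt : ~ E x y t.
  move=> Eyt; have heavy2 : 2 < #|edges_at2 H x w'| by apply: leq_trans heavy'.
  have [r r_new Er] := @pick_codegree x w' [:: y; t] xw' heavy2.
  have tz' : t != z by by_neqs.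
  have := key t w' r Eyt tz' Er; rewrite !inE => /(_ _ _)/orP[]; try by by_neqs.
    by move/eqP=> def_t; subst t; have [_ _] := edge_neq Et; rewrite eqxx.
  by move/eqP=> def_t; subst t; move: r_new; rewrite !inE eqxx orbT.
have [_ _ tE] := mem_edge3 x w' t.
have := @degree_cover t [:: [set t; x; w']; [set t; y; z]] [::].
have := deg_gt16 Et tE => + cov; move/leq_trans/(_ (cov _)) => {cov} H1.
suff : 16 < size [:: [set t; x; w']; [set t; y; z]] +
            \sum_(u <- [::]) #|edges_at2 H t u| by rewrite big_nil.
apply: H1 => e eH te; rewrite orbF !inE.
have [xe|xe] := boolP (x \in e).
  have tx : t != x by by_neqs.
  have [r def_e] := edge_at2_shape eH tx te xe; rewrite {}def_e in eH *.
  have yt : y != t by by_neqs.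
  have yr : y != r by apply/eqP => yr; subst r; apply: not_yt; by_perm.
  have Extr : E x t r by by_perm.
  have := key w' t r Ew' w'z Extr yt yr; rewrite !inE => /orP[]/eqP def; subst w'.
    by have [_ _] := edge_neq Et; rewrite eqxx.
  by rewrite eqxx.
have [ye|ye] := boolP (y \in e).
  have ty : t != y by by_neqs.
  have [r def_e] := edge_at2_shape eH ty te ye; rewrite {}def_e in eH xe *.
  have Eytr : E y t r by by_perm.
  have := at_y t r Eytr; rewrite !inE; move: xe; rewrite !inE !negb_or => /andP[/andP[xt _] xr].
  rewrite (negPf xt) (negPf xr) /= => /orP[]/eqP def_z; subst z.
    by move: t_new; rewrite !inE eqxx orbT.
  by rewrite eqxx orbT.
have w'e : w' \notin e.
  by apply: contra xe => w'e; case/andP: tw' => _ /forall_inP; apply; rewrite inE eH.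
have ze : z \notin e.
  by apply: contra ye => ze; case/andP: tz => _ /forall_inP; apply; rewrite inE eH.
have [p [r def_e]] := edge_at_shape eH te; rewrite {}def_e in eH xe ye ze w'e.
by path7 p r t w' x y z; case/negP; by_neqs.
Qed.

Lemma no_two_fat x y z : E x y z -> fat H x -> fat H y -> False.
Proof.
move=> Exyz fx fy; have Eyxz : E y x z by by_perm.
have [pY|nopY] := boolP (private_edge x y z); have [pX|nopX] := boolP (private_edge y x z).
- have [tx heavy] := private_edge_thin Exyz fx fy pY.
  have [ty _] := private_edge_thin Eyxz fy fx pX.
  exact: (thin_thin_light Exyz tx ty heavy).
- exact: (private_one_side Eyxz fy fx pY nopX).
- exact: (private_one_side Exyz fx fy pX nopY).
- have [ty _] := no_private_edge Exyz fx fy nopY.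
  have [tx heavy] := no_private_edge Eyxz fy fx nopX.
  by apply: (thin_thin_light Exyz tx ty); apply: leq_trans heavy.
Qed.

(** If [b] is the centre of [a] and [c] the centre of [b], then every edge at
    [a] contains [b], hence [c], and [a] has degree 1. *)
Lemma two_thin x y z u v : E x y z -> thin H x u -> thin H y v ->
  (u = z /\ v = z) \/ (u = y /\ v = x).
Proof.
suff oriented a b c : E a b c -> thin H a b -> ~ thin H b c.
  move=> Exyz tx ty; have Eyxz : E y x z by by_perm.
  case: (thinP tx Exyz) => def_u; case: (thinP ty Eyxz) => def_v; subst u v.
  - by right.
  - by case: (oriented _ _ _ Exyz tx ty).
  - by case: (oriented _ _ _ Eyxz ty tx).
  - by left.
move=> Eabc /andP[ba /forall_inP ta] /andP[cb /forall_inP tb].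
have [aE _ _] := mem_edge3 a b c.
have := @degree_cover a [:: [set a; b; c]] [::].
have := deg_gt16 Eabc aE => + cov; move/leq_trans/(_ (cov _)) => {cov} H1.
suff : 16 < size [:: [set a; b; c]] + \sum_(u <- [::]) #|edges_at2 H a u|.
  by rewrite big_nil.
apply: H1 => e eH ae; rewrite orbF inE.
have be : b \in e by apply: ta; rewrite inE eH.
have ce : c \in e by apply: tb; rewrite inE eH.
rewrite eq_sym eqEcard (H3 eH) (H3 Eabc) leqnn andbT.
by apply/subsetP=> w; rewrite !inE -orbA => /or3P[]/eqP->.
Qed.

Definition centre x := odflt x [pick v | thin H x v].

Definition leaves := [set x in cover H | ~~ fat H x].

Lemma centreP x : x \in leaves -> thin H x (centre x).
Proof.
rewrite inE => /andP[_ /forallPn[v]]; rewrite negbK => tv.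
by rewrite /centre; case: pickP => [//|/(_ v)]; rewrite tv.
Qed.

Lemma leaf_or_fat e x : e \in H -> x \in e -> (x \in leaves) || fat H x.
Proof.
move=> eH xe; rewrite inE.
by have -> : x \in cover H; [apply/bigcupP; exists e | case: (fat H x)].
Qed.

Lemma edge_two_leaves e : e \in H ->
  exists x y z, [/\ e = [set x; y; z], x \in leaves & y \in leaves].
Proof.
move=> eH; have /set0Pn[a ae] : e != set0 by rewrite -card_gt0 H3.
have [b [c def_e]] := edge_at_shape eH ae; rewrite {}def_e in eH ae *.
have [aE bE cE] := mem_edge3 a b c.
have Eacb : E a c b by by_perm.
have Ebca : E b c a by by_perm.
case/orP: (leaf_or_fat eH aE) => La; case/orP: (leaf_or_fat eH bE) => Lb.
- by exists a, b, c.
- case/orP: (leaf_or_fat eH cE) => Lc; last by case: (no_two_fat Ebca Lb Lc).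
  by exists a, c, b; rewrite setUAC.
- case/orP: (leaf_or_fat eH cE) => Lc; last by case: (no_two_fat Eacb La Lc).
  by exists b, c, a; rewrite -setUA setUC.
- by case: (no_two_fat eH La Lb).
Qed.

Lemma leaf_degree x (U : {set V}) : (forall e, e \in H -> e \subset U) ->
  x \in leaves -> #|edges_at H x| <= #|U| - 2.
Proof.
move=> HU xL; have /andP[] := centreP xL; set v := centre x => vx /forall_inP tv.
have xU : x \in U.
  by move: xL; rewrite inE => /andP[/bigcupP[e /HU /subsetP eU /eU]].
have [->|[e0 e0x]] := set_0Vmem (edges_at H x); first by rewrite cards0.
have vU : v \in U.
  by have := e0x; rewrite inE => /andP[/HU/subsetP eU _]; apply/eU/tv.
have -> : #|U| - 2 = #|U :\ x :\ v|.
  by rewrite (cardsD1 x U) (cardsD1 v (U :\ x)) xU !inE vx vU /=; lia.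
apply: leq_trans (leq_imset_card (fun w => [set x; v; w]) _).
apply/subset_leq_card/subsetP => e ex; have := ex; rewrite inE => /andP[eH xe].
have xv : x != v by rewrite eq_sym.
have [w def_e] := edge_at2_shape eH xv xe (tv e ex).
rewrite {}def_e in eH *; apply: imset_f; have [_ xw vw] := edge_neq eH.
rewrite !inE ![w == _]eq_sym xw vw (subsetP (HU _ eH)) //.
by rewrite !inE eqxx orbT.
Qed.

Lemma double_count (L : {set V}) :
  \sum_(e in H) #|e :&: L| = \sum_(x in L) #|edges_at H x|.
Proof.
under eq_bigr do rewrite -sum1_card.
under [RHS]eq_bigr do rewrite -sum1_card.
rewrite (exchange_big_dep (mem L)) /=; last by move=> e x _; rewrite in_setI => /andP[].
by apply: eq_bigr => x xL; apply: eq_bigl => e; rewrite !inE xL andbT.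
Qed.

(** Every edge has two leaves, and an edge at a leaf [x] is determined by its
    vertex different from [x] and the centre of [x]. *)
Lemma leaves_bound (U : {set V}) : (forall e, e \in H -> e \subset U) ->
  2 * #|H| <= #|leaves| * (#|U| - 2).
Proof.
move=> HU; rewrite mulnC -sum_nat_const.
apply: (@leq_trans (\sum_(e in H) #|e :&: leaves|)).
  apply: leq_sum => e eH; have [x [y [z [def_e xL yL]]]] := edge_two_leaves eH.
  subst e; have [xy _ _] := edge_neq eH.
  have <- : #|[set x; y]| = 2 by rewrite cards2 xy.
  apply/subset_leq_card/subsetP => w; rewrite !inE => /orP[]/eqP->; rewrite eqxx ?orbT /=.
    by move: xL; rewrite inE.
  by move: yL; rewrite inE.
rewrite double_count -sum_nat_const; apply: leq_sum => x; exact: leaf_degree.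
Qed.

End Structure.

(** What the counting argument keeps of the structure of a colour class: leaves
    [T] with centre map [s], every edge being of star type or of pair type. *)
Definition oriented H (T : {set V}) (s : V -> V) :=
  (forall e x, e \in H -> x \in e -> x \in T -> s x \in e /\ s x != x) /\
  (forall e, e \in H -> exists x y z, [/\ e = [set x; y; z], x \in T, y \in T &
     (s x = z /\ s y = z) \/ (s x = y /\ s y = x)]).

Lemma leaves_oriented H : uniform3 H -> path_free H ->
  (forall x e, e \in H -> x \in e -> 16 < #|edges_at H x|) ->
  oriented H (leaves H) (centre H).
Proof.
move=> H3 pfH deg; split=> [e x eH xe /centreP/andP[cx /forall_inP tc]|e eH].
  by split=> //; apply: tc; rewrite inE eH.
have [x [y [z [def_e xL yL]]]] := edge_two_leaves H3 pfH deg eH; subst e.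
exists x, y, z; split=> //.
exact: (two_thin H3 deg eH (centreP xL) (centreP yL)).
Qed.

Definition inside H (U : {set V}) := [set e in H | e \subset U].

(** Peeling stops at 7 vertices, where the trivial bound ['C(7, 3)] on the number
    of edges is better than 16 per vertex; this saving is needed when there are
    very few colours. *)
Lemma peel H (U : {set V}) : 7 <= #|U| -> exists U' : {set V},
  [/\ 7 <= #|U'| <= #|U|, #|inside H U| <= #|inside H U'| + 16 * (#|U| - #|U'|) &
    #|U'| = 7 \/ forall x, x \in U' -> 16 < #|edges_at (inside H U') x|].
Proof.
move: {2}(#|U| - 7) (leqnn (#|U| - 7)) => m; elim: m U => [|m IHm] U leUm U7.
  by exists U; split; [lia | lia | left; lia].
have [/forall_inP deg|/forall_inPn[x xU]] :=
  boolP [forall x in U, 16 < #|edges_at (inside H U) x|].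
  by exists U; split; [lia | lia | right].
rewrite -leqNgt => deg_x; have [U_7|U_neq7] := eqVneq #|U| 7.
  by exists U; split; [lia | lia | left].
have cardU : #|U| = #|U :\ x|.+1 by rewrite (cardsD1 x) xU.
have [||U' [cardU' cardH lastU']] := IHm (U :\ x); [lia | lia |].
exists U'; split=> //; first by lia.
suff : #|inside H U| <= #|inside H (U :\ x)| + 16 by lia.
rewrite -(cardsID [set e : {set V} | x \in e] (inside H U)) addnC leq_add //.
  apply/subset_leq_card/subsetP => e; rewrite !inE => /andP[xe /andP[-> eU]] /=.
  by rewrite subsetD1 eU xe.
by apply: leq_trans deg_x; apply/subset_leq_card/subsetP => e; rewrite !inE.
Qed.

Lemma card_uniform3 H (U : {set V}) : uniform3 H -> (forall e, e \in H -> e \subset U) ->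
  #|H| <= 'C(#|U|, 3).
Proof.
move=> H3 HU; rewrite -cards_draws; apply/subset_leq_card/subsetP => e eH.
by rewrite inE HU ?H3 /=.
Qed.

Lemma path_free_structure H : uniform3 H -> path_free H -> 7 <= #|V| ->
  #|H| <= 16 * (#|V| - 7) + 35 \/
  exists u (G : {set {set V}}) T s, [/\ G \subset H, oriented G T s,
    #|H| <= #|G| + 16 * (#|V| - u), #|T| <= u & 7 <= u <= #|V| /\ 2 * #|G| <= u * (u - 2)].
Proof.
move=> H3 pfH V7; have [|U [cardU cardH lastU]] := @peel H [set: V]; first by rewrite cardsT.
have HV : inside H [set: V] = H by apply/setP=> e; rewrite inE subsetT andbT.
rewrite HV cardsT in cardU cardH.
have sGH : inside H U \subset H by apply/subsetP=> e; rewrite inE => /andP[].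
have G3 := uniform3_sub sGH H3; have pfG := path_free_sub sGH pfH.
have GU e : e \in inside H U -> e \subset U by rewrite inE => /andP[].
case: lastU => [U_7|deg].
  left; have := card_uniform3 G3 GU; rewrite U_7 => GC; have : 'C(7, 3) = 35 by [].
  by move: GC cardH cardU; rewrite U_7; move: 'C(7, 3) #|inside H U| #|H| #|V|; clear; lia.
have degG x e : e \in inside H U -> x \in e -> 16 < #|edges_at (inside H U) x|.
  by move=> eG xe; apply: deg; apply: (subsetP (GU e eG)).
right; exists #|U|, (inside H U), (leaves (inside H U)), (centre (inside H U)).
have TU : #|leaves (inside H U)| <= #|U|.
  apply/subset_leq_card/subsetP=> x; rewrite inE => /andP[/bigcupP[e eG xe] _].
  by apply: (subsetP (GU e eG)).
split=> //; first exact: leaves_oriented.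
split=> //; apply: leq_trans (leaves_bound G3 pfG degG GU) _.
by rewrite leq_mul2r TU orbT.
Qed.

Lemma path_free_card H : uniform3 H -> path_free H -> 7 <= #|V| ->
  2 * #|H| <= maxn (32 * (#|V| - 7) + 70) (#|V| * (#|V| - 2)).
Proof.
move=> H3 pfH V7; rewrite leq_max.
case: (path_free_structure H3 pfH V7) => [sH|[u [G [T [s [_ _ sH _ [uV sG]]]]]]].
  by apply/orP; left; lia.
move: #|H| #|G| #|V| uV sH sG V7 => h g N uV sH sG N7.
have hb : 2 * h <= u * (u - 2) + 32 * (N - u) by lia.
have [Nu|Nu] := leqP 34 (N + u).
  by apply/orP; right; apply: leq_trans hb _; clear -uV Nu; nia.
by apply/orP; left; apply: leq_trans hb _; clear -uV Nu; nia.
Qed.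

(** Every 16 discarded edges are paid for by a vertex that is not a leaf. If
    peeling reaches 7 vertices, all edges are discarded. *)
Lemma path_free_oriented H : uniform3 H -> path_free H -> 7 <= #|V| ->
  exists (G : {set {set V}}) T s,
    [/\ G \subset H, oriented G T s & #|H :\: G| + 16 * #|T| <= 16 * #|V|].
Proof.
move=> H3 pfH V7.
case: (path_free_structure H3 pfH V7) => [sH|[u [G [T [s [sGH or sH sT [uV _]]]]]]].
  exists set0, set0, id; split; first exact: sub0set.
    by split=> e; rewrite ?inE // => x; rewrite inE.
  by rewrite setD0 cards0; lia.
exists G, T, s; split=> //.
have := cardsID G H; have -> : H :&: G = G by apply/setIidPr.
by lia.
Qed.

End PathFree.

(** * Counting triples along centre arcs *)

Lemma cards3 (V : finType) (a b c : V) : a != b -> a != c -> b != c ->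
  #|[set a; b; c]| = 3%N.
Proof.
by move=> ab ac bc; rewrite -setUA cardsU1 cards2 bc !inE negb_or ab ac.
Qed.

Lemma leq_card_bigcup (I T : finType) (P : pred I) (F : I -> {set T}) :
  (#|\bigcup_(i | P i) F i| <= \sum_(i | P i) #|F i|)%N.
Proof.
apply: (big_rec2 (fun (A : {set T}) m => #|A| <= m)%N) => [|i m A _ IH].
  by rewrite cards0.
by apply: leq_trans (leq_card_setU _ _) _; rewrite leq_add2l.
Qed.

Lemma bin3_mul6 N : ('C(N, 3) * 6 = N * (N - 1) * (N - 2))%N.
Proof.
by rewrite -[6%N]/(3`!)%N bin_ffact !ffactnS ffactn0 !subn1 subn2 muln1 mulnA.
Qed.

(** The case of interest: [N] points and [n] colours, [k = N - 2 - n], [m] pairs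
    without an arc, [b] deleted triples, [t] leaves in all colours together, [q]
    triples with two arcs to the same vertex, [C] triples in all.
    With [D = n N - t], [b <= 16 D], and [2 k C] is bounded by [(2 k + 6 n) 16 D + k (n - 1) t]:
    up to the factor [n N = D + t], a weighted mean of the two quantities in the
    maximum. *)
Lemma oriented_count_arith (N n k m b t q C : nat) (M := maxn (32 * k + 96 * n) (k * (n - 1))) :
  (0 < k -> m * k <= 3 * b -> b + 16 * t <= 16 * (n * N) -> 2 * q <= (n - 1) * t ->
  C <= b + m * n + q -> C * 6 = N * (N - 1) * (N - 2) ->
  (N - 1) * (N - 2) * k <= 3 * n * M)%N.
Proof.
move=> k_gt0 mb bt qt C_le C6.
have M1 : (32 * k + 96 * n <= M)%N := leq_maxl _ _.
have M2 : (k * (n - 1) <= M)%N := leq_maxr _ _.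
move: M M1 M2 => M M1 M2.
have [->//|N_gt0] := posnP N.
rewrite -(leq_pmul2l N_gt0).
have -> : (N * ((N - 1) * (N - 2) * k) = 3 * (2 * k * C))%N.
  by rewrite !mulnA -C6; lia.
have -> : (N * (3 * n * M) = 3 * (n * N * M))%N by lia.
rewrite leq_mul2l /=.
have s1 : (2 * k * C <= (2 * k + 6 * n) * b + k * ((n - 1) * t))%N.
  have : (2 * k * C <= 2 * k * (b + m * n + q))%N by rewrite leq_mul2l C_le orbT.
  have : (2 * n * (m * k) <= 2 * n * (3 * b))%N by rewrite leq_mul2l mb orbT.
  have : (k * (2 * q) <= k * ((n - 1) * t))%N by rewrite leq_mul2l qt orbT.
  by lia.
apply: leq_trans s1 _.
have tN : (t <= n * N)%N by lia.
have bD : (b <= 16 * (n * N - t))%N by lia.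
apply: (@leq_trans (M * (n * N - t) + M * t)%N); last first.
  by rewrite -mulnDr subnK // mulnC.
apply: leq_add; last by rewrite mulnA leq_mul2r M2 orbT.
apply: leq_trans (leq_mul (leqnn _) bD) _.
by rewrite mulnA leq_mul2r; apply/orP; right; lia.
Qed.

Section Counting.
Local Open Scope nat_scope.

Variables (V : finType) (n : nat) (c : {ffun {set V} -> 'I_n}).
Variables (G : 'I_n -> {set {set V}}) (T : 'I_n -> {set V}) (s : 'I_n -> V -> V).
Hypothesis G_sub : forall k, G k \subset color_class c k.
Hypothesis G_or : forall k, oriented (G k) (T k) (s k).

Local Notation N := #|V|.

Lemma color_classP k e : (e \in color_class c k) = (#|e| == 3) && (c e == k).
Proof. by rewrite !inE. Qed.

Lemma oriented_edgeP k e : e \in G k -> #|e| = 3 /\ c e = k.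
Proof. by move/(subsetP (G_sub k)); rewrite color_classP => /andP[/eqP-> /eqP->]. Qed.

Definition oriented_triples := [set e in complete3 V | e \in G (c e)].
Definition stray_triples := [set e in complete3 V | e \notin G (c e)].

Definition arc v x := [exists k, (x \in T k) && (s k x == v)].

Definition tails x := [set v | arc v x].

Definition nonadjacent := [set A : {set V} |
  (#|A| == 2) && [forall x in A, forall y in A, (x != y) ==> ~~ arc x y]].

Lemma arcI k x : x \in T k -> arc (s k x) x.
Proof. by move=> xT; apply/existsP; exists k; rewrite xT eqxx. Qed.

Lemma tails_leq x : #|tails x| <= #|[set k | x \in T k]|.
Proof.
apply: leq_trans (leq_imset_card (fun k => s k x) _).
apply/subset_leq_card/subsetP => v; rewrite inE => /existsP[k /andP[xT /eqP <-]].
by apply: imset_f; rewrite inE.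
Qed.

(** One of the two vertices of [A] is a leaf in the colour of [e]; its centre is
    not in [A], so it is the third vertex of both [e] and [e']. *)
Lemma nonadjacent_color A e e' : A \in nonadjacent ->
  e \in oriented_triples -> e' \in oriented_triples -> A \subset e -> A \subset e' -> c e = c e' -> e = e'.
Proof.
rewrite !inE => /andP[/cards2P[p [q [pq def_A]]] /forall_inP nonadj].
move=> /andP[_ eG] /andP[_ e'G] Ae Ae' ce; rewrite -{}ce in e'G; move: (c e) eG e'G => k eG e'G.
have third p' q' f : p' \in T k -> A = [set p'; q'] -> p' != q' -> f \in G k -> A \subset f ->
    f = [set p'; q'; s k p'].
  move=> p'T def_A' p'q' fG /subsetP Af; have [f3 _] := oriented_edgeP fG.
  have p'A : p' \in A by rewrite def_A' !inE eqxx.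
  have q'A : q' \in A by rewrite def_A' !inE eqxx orbT.
  have [sf sp] := (G_or k).1 f p' fG (Af _ p'A) p'T.
  have sq : s k p' != q'.
    apply: contraTneq (arcI p'T) => ->.
    have /forall_inP/(_ _ p'A) := nonadj _ q'A.
    by rewrite eq_sym p'q'.
  apply/esym/eqP; rewrite eqEcard; apply/andP; split.
    apply/subsetP => w; rewrite !inE => /orP[/orP[]|] /eqP->; [exact: Af | exact: Af | done].
  by rewrite f3 cards3 // eq_sym // eq_sym.
have [x [y [z [def_e xT yT _]]]] := (G_or k).2 e eG.
have [pT|pT] := boolP (p \in T k).
  exact: etrans (third p q e pT def_A pq eG Ae) (esym (third p q e' pT def_A pq e'G Ae')).
have qT : q \in T k.
  have : q \in e by rewrite (subsetP Ae) // def_A !inE eqxx orbT.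
  have : p \in e by rewrite (subsetP Ae) // def_A !inE eqxx.
  rewrite def_e !inE -!orbA.
  case/or3P=> /eqP def_p; [by rewrite def_p xT in pT | by rewrite def_p yT in pT |].
  case/or3P=> /eqP def_q; [by rewrite def_q | by rewrite def_q |].
  by rewrite def_p def_q eqxx in pq.
have def_A' : A = [set q; p] by rewrite def_A setUC.
have qp : q != p by rewrite eq_sym.
exact: etrans (third q p e qT def_A' qp eG Ae) (esym (third q p e' qT def_A' qp e'G Ae')).
Qed.

Lemma card_triples : #|oriented_triples| + #|stray_triples| = 'C(N, 3).
Proof.
have -> : 'C(N, 3) = #|complete3 V|.
  rewrite -cardsT -cards_draws; apply: eq_card => e.
  by rewrite !inE subsetT.
rewrite -(cardsID [set e | e \in G (c e)] (complete3 V)).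
by congr (_ + _); apply: eq_card => e; rewrite !inE // andbC.
Qed.

Lemma nonadjacent_oriented A : A \in nonadjacent ->
  #|[set e in oriented_triples | A \subset e]| <= n.
Proof.
move=> An; rewrite -[X in _ <= X](card_ord n).
rewrite -(card_in_imset (f := c)) ?max_card // => e e'.
rewrite !inE -!andbA => /and3P[e3 eG Ae] /and3P[e'3 e'G Ae'].
by apply: nonadjacent_color An _ _ Ae Ae'; rewrite !inE ?e3 ?e'3.
Qed.

Lemma nonadjacent_stray A : A \in nonadjacent ->
  N - 2 - n <= #|[set e in stray_triples | A \subset e]|.
Proof.
move=> An; have := nonadjacent_oriented An.
suff : N - 2 <= #|[set e in oriented_triples | A \subset e]| + #|[set e in stray_triples | A \subset e]|.
  by move: #|_| #|_| #|_| => p q r; clear; lia.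
have /andP[/eqP A2 _] : (#|A| == 2) && true by move: An; rewrite inE => /andP[->].
have -> : N - 2 = #|~: A| by rewrite -(cardsC A) A2 addKn.
rewrite -(card_in_imset (f := fun w => w |: A)).
  apply: leq_trans (leq_card_setU _ _).
  apply/subset_leq_card/subsetP => _ /imsetP[w wA ->]; rewrite inE in wA.
  by rewrite !inE cardsU1 wA A2 subsetUr /= !andbT; case: (_ \in _).
move=> w w'; rewrite !inE => wA w'A eww'; have : w \in w' |: A by rewrite -eww' setU11.
by rewrite !inE (negPf wA) orbF => /eqP.
Qed.

Lemma card_nonadjacent : #|nonadjacent| * (N - 2 - n) <= 3 * #|stray_triples|.
Proof.
rewrite -sum_nat_const; apply: (@leq_trans (\sum_(A in nonadjacent)
   #|[set e in stray_triples | A \subset e]|)); first by apply: leq_sum => A; exact: nonadjacent_stray.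
under eq_bigr do rewrite -sum1_card.
rewrite (exchange_big_dep (mem stray_triples)) /=; last by move=> A e _; rewrite in_set => /andP[].
rewrite mulnC -sum_nat_const; apply: leq_sum => e eb.
have e3 : #|e| = 3 by move: eb; rewrite !inE => /andP[/eqP].
rewrite sum1dep_card; have <- : 'C(#|e|, 2) = 3 by rewrite e3.
rewrite -cards_draws; apply/subset_leq_card/subsetP => A.
by rewrite !inE => /andP[/andP[-> _] /andP[_ ->]].
Qed.

Definition cherries x :=
  [set x |: A | A in [set A : {set V} | A \subset tails x & #|A| == 2]].

Lemma cherry u v w : arc u w -> arc v w -> u != v -> [set w; u; v] \in cherries w.
Proof.
move=> au av uv; rewrite -setUA; apply: imset_f; rewrite inE cards2 uv eqxx andbT.
by apply/subsetP => t; rewrite !inE => /orP[]/eqP->.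
Qed.

(** In a star [x y z] with centre [z], the arc between [x] and [y] completes a
    cherry; in the pair type [x] and [y] are joined both ways, and an arc
    from [z] to one of them completes a cherry there, while otherwise
    both have arcs to [z]. *)
Lemma adjacent_cherry e : e \in oriented_triples -> (forall x y, x \in e -> y \in e -> x != y ->
  arc x y \/ arc y x) -> exists x, e \in cherries x.
Proof.
rewrite inE => /andP[_]; move: (c e) => k eG adj.
have [x [y [z [def_e xT yT sxy]]]] := (G_or k).2 e eG.
have [e3 _] := oriented_edgeP eG.
have [xe ye ze] : [/\ x \in e, y \in e & z \in e].
  by rewrite def_e !inE !eqxx !orbT.
have [xy xz yz] : [/\ x != y, x != z & y != z].
  have := e3; rewrite def_e; case: (eqVneq x y) => [->|xy].
    by rewrite setUid cards2; case: (_ != _).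
  case: (eqVneq x z) => [->|xz].
    by rewrite [ [set z; y; z] ]setUAC setUid cards2; case: (_ != _).
  by case: (eqVneq y z) => [->|//]; rewrite -setUA setUid cards2; case: (_ != _).
have ax := arcI xT; have ay := arcI yT.
have eyxz : [set x; y; z] = [set y; x; z] by rewrite [ [set y; x] ]setUC.
have ezxy : [set x; y; z] = [set z; x; y] by rewrite setUC setUA.
case: sxy => -[sx sy]; rewrite sx in ax; rewrite sy in ay.
  case: (adj x y xe ye xy) => a; [exists y | exists x]; rewrite def_e.
    by rewrite eyxz; apply: cherry.
  by apply: cherry.
case: (adj y z ye ze yz) => ayz; last first.
  by exists y; rewrite def_e eyxz; apply: cherry.
case: (adj x z xe ze xz) => axz; last first.
  by exists x; rewrite def_e; apply: cherry.
by exists z; rewrite def_e ezxy; apply: cherry.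
Qed.

(** In-degrees are compared with the number of colours where [x] is a leaf, and
    not just with [n], to make the bound linear in that number. *)
Lemma card_cherries x : 2 * #|cherries x| <= (n - 1) * #|[set k | x \in T k]|.
Proof.
have t_le : #|[set k | x \in T k]| <= n by rewrite -[X in _ <= X](card_ord n) max_card.
have c_le : #|cherries x| <= 'C(#|tails x|, 2).
  by rewrite -cards_draws; apply: leq_imset_card.
have := tails_leq x; move: t_le c_le.
move: #|[set k | x \in T k]| #|cherries x| #|tails x| => t q d tn qC dt.
have : 'C(d, 2) * 2`! = d * d.-1 by rewrite bin_ffact ffactnS ffactn1.
by move=> h; have : q * 2 <= d * d.-1 by [rewrite -h leq_mul2r qC orbT]; nia.
Qed.

Lemma card_oriented : #|oriented_triples| <= #|nonadjacent| * n + \sum_x #|cherries x|.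
Proof.
apply: (@leq_trans #|\bigcup_(A in nonadjacent) [set e in oriented_triples | A \subset e]
    :|: \bigcup_x cherries x|).
  apply/subset_leq_card/subsetP => e eg.
  have [adj|] := boolP [forall x in e, forall y in e, (x != y) ==> arc x y || arc y x].
    have [|x ex] := adjacent_cherry eg.
      move=> x y xe ye xy; move/forall_inP/(_ x xe)/forall_inP/(_ y ye): adj.
      by rewrite xy => /orP[]; [left | right].
    by rewrite inE; apply/orP; right; apply/bigcupP; exists x.
  case/forall_inPn => x xe /forall_inPn[y ye]; rewrite negb_imply negb_or.
  case/and3P=> xy axy ayx; rewrite inE; apply/orP; left.
  apply/bigcupP; exists [set x; y]; last first.
    by rewrite inE eg; apply/subsetP=> w; rewrite !inE => /orP[]/eqP->.
  rewrite inE cards2 xy /=; apply/forall_inP => p; rewrite !inE => p_in.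
  apply/forall_inP=> q; rewrite !inE => q_in; apply/implyP.
  by case/orP: p_in => /eqP->; case/orP: q_in => /eqP->; rewrite ?eqxx.
apply: leq_trans (leq_card_setU _ _) _; apply: leq_add.
  apply: leq_trans (leq_card_bigcup _ _) _; rewrite -sum_nat_const.
  by apply: leq_sum => A; exact: nonadjacent_oriented.
exact: leq_card_bigcup.
Qed.

Lemma card_stray : #|stray_triples| <= \sum_k #|color_class c k :\: G k|.
Proof.
apply: leq_trans (leq_card_bigcup xpredT _); apply/subset_leq_card/subsetP => e.
rewrite inE => /andP[e3 eG]; apply/bigcupP; exists (c e) => //.
by rewrite inE eG !inE; rewrite inE in e3; rewrite e3 eqxx.
Qed.

Lemma sum_leaves : \sum_x #|[set k | x \in T k]| = \sum_k #|T k|.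
Proof.
under eq_bigr do rewrite -sum1_card.
rewrite (exchange_big_dep xpredT) //=; apply: eq_bigr => k _.
by rewrite sum1dep_card; apply: eq_card => x; rewrite !inE.
Qed.

Hypothesis few_stray : forall k, #|color_class c k :\: G k| + 16 * #|T k| <= 16 * N.

Lemma oriented_count :
  (N - 1) * (N - 2) * (N - 2 - n) <=
  3 * n * maxn (32 * (N - 2 - n) + 96 * n) ((N - 2 - n) * (n - 1)).
Proof.
set k := N - 2 - n.
have [->|k_gt0] := posnP k; first by rewrite muln0.
set m := #|nonadjacent|; set b := #|stray_triples|; pose t := \sum_k #|T k|.
have mb : m * k <= 3 * b := card_nonadjacent.
have bt : b + 16 * t <= 16 * (n * N).
  have : \sum_(j : 'I_n) (#|color_class c j :\: G j| + 16 * #|T j|) <= \sum_(j : 'I_n) 16 * N.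
    by apply: leq_sum => j _; exact: few_stray.
  rewrite big_split -big_distrr /= sum_nat_const card_ord.
  move=> sum_le; rewrite mulnCA; apply: leq_trans sum_le.
  by rewrite leq_add2r; exact: card_stray.
have qt : 2 * (\sum_x #|cherries x|) <= (n - 1) * t.
  rewrite /t -sum_leaves !big_distrr /=; apply: leq_sum => x _; exact: card_cherries.
have total := card_oriented; have all := card_triples; rewrite -/m -/b in total all.
have C_le : 'C(N, 3) <= b + m * n + \sum_x #|cherries x|.
  by rewrite -all addnC -addnA leq_add2l.
exact: oriented_count_arith k_gt0 mb bt qt C_le (bin3_mul6 N).
Qed.

End Counting.

(** * Colourings without a monochromatic path *)

Lemma no_copy_path_free (V : finType) (H : {set {set V}}) :
  ~~ contains_copy path3_3 H -> path_free H.
Proof.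
move=> noH a b c d e f g Eabc Ecde Eefg; apply: contra noH => us.
apply/existsP; exists [ffun i : 'I_7 => nth a [:: a; b; c; d; e; f; g] i].
apply/andP; split.
  apply/injectiveP => i j; rewrite !ffunE => /eqP.
  by rewrite nth_uniq ?ltn_ord // => /eqP/val_inj.
apply/forall_inP => x; rewrite !inE -orbA => /or3P[] /eqP->;
  by rewrite !(imsetU, imset_set1) !ffunE !inordK.
Qed.

Lemma color_class_uniform3 (V : finType) n (c : {ffun {set V} -> 'I_n}) k :
  uniform3 (color_class c k).
Proof. by move=> e; rewrite !inE => /andP[/eqP]. Qed.

Lemma not_arrow n N : ~~ ramsey_arrow n N -> exists c : {ffun {set 'I_N} -> 'I_n},
  forall k, path_free (color_class c k).
Proof.
case/forallPn=> c /existsPn noc; exists c => k; exact: no_copy_path_free (noc k).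
Qed.

Lemma not_arrow_card n N : ~~ ramsey_arrow n N -> (7 <= N)%N ->
  (N * (N - 1) * (N - 2) <= 3 * n * maxn (32 * (N - 7) + 70) (N * (N - 2)))%N.
Proof.
move=> /not_arrow[c pfc] N7.
have sum_class : ('C(N, 3) <= \sum_k #|color_class c k|)%N.
  have -> : 'C(N, 3) = #|complete3 'I_N|.
    rewrite -[in LHS](card_ord N) -cardsT -cards_draws; apply: eq_card => e.
    by rewrite !inE subsetT.
  apply: leq_trans (leq_card_bigcup xpredT _); apply/subset_leq_card/subsetP => e.
  by rewrite inE => e3; apply/bigcupP; exists (c e); rewrite // !inE e3 eqxx.
set M := maxn _ _.
have : (\sum_(k < n) 2 * #|color_class c k| <= \sum_(k < n) M)%N.
  apply: leq_sum => k _.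
  have := path_free_card (@color_class_uniform3 _ _ c k) (pfc k).
  by rewrite card_ord => /(_ N7).
rewrite -big_distrr sum_nat_const card_ord /= -bin3_mul6 => sum_le.
by rewrite -mulnA; move: sum_class sum_le; move: (\sum_k _)%N 'C(N, 3) M; clear; lia.
Qed.

Lemma not_arrow_oriented n N : ~~ ramsey_arrow n N -> (7 <= N)%N ->
  ((N - 1) * (N - 2) * (N - 2 - n) <=
   3 * n * maxn (32 * (N - 2 - n) + 96 * n) ((N - 2 - n) * (n - 1)))%N.
Proof.
move=> /not_arrow[c pfc] N7.
have N7' : (7 <= #|'I_N|)%N by rewrite card_ord.
have /fin_all_exists[G /fin_all_exists[T /fin_all_exists[s Gs]]] :=
  fun k => path_free_oriented (@color_class_uniform3 _ _ c k) (pfc k) N7'.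
rewrite -[N](card_ord N).
by apply: (@oriented_count _ n c G T s) => k; case: (Gs k).
Qed.

(** * Arithmetic of the two bounds *)

Lemma oriented_bound_fails n N : (25 <= n)%N -> (197 * n + 3400 <= 100 * N)%N ->
  ~~ ((N - 1) * (N - 2) * (N - 2 - n) <=
   3 * n * maxn (32 * (N - 2 - n) + 96 * n) ((N - 2 - n) * (n - 1)))%N.
Proof.
move=> n25 hN; rewrite -ltnNge.
have [k def_N] : exists k, N = (k + n + 2)%N by exists (N - 2 - n)%N; lia.
subst N; have -> : (k + n + 2 - 1 = k + n + 1)%N by lia.
have -> : (k + n + 2 - 2 = k + n)%N by lia.
rewrite addnK; have hk : (97 * n + 3200 <= 100 * k)%N by lia.
have hS : (197 * n + 3200 <= 100 * (k + n))%N by lia.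
have h1 : (388 * (n * n) + 126 * 100 * n + 1024 * 100 <= 100 * ((k + n) * (k + n)))%N.
  by have := leq_mul hS hS; lia.
rewrite maxnMr gtn_max; apply/andP; split; last first.
  have k_gt0 : (0 < k)%N by lia.
  rewrite [X in (X < _)%N]mulnCA [X in (_ < X)%N]mulnC ltn_pmul2l //.
  by have := leq_mul (leqnn n) hS; lia.
have h2 := leq_mul h1 (leqnn k).
have h3 := leq_mul (leqnn (388 * (n * n) + 3000 * n)%N) hk.
have sq_ge0 (x : int) : (0 <= x * x)%R by rewrite -expr2 sqr_ge0.
(* The square is a lower bound for [37636 n^2 - 1347400 n + 19532800], the
   quadratic factor of the cubic that remains. *)
have h4 := mulr_ge0 (ler0n int n) (sq_ge0 (194 * n%:Z - 3473)%R).
lia.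
Qed.

(** The lower bounds on [N] are consequences of [N + 1 > 1.97 n + 7 sqrt n]. *)
Lemma size_bound_fails n N :
  [|| (n == 1%N) && (8 <= N), (n == 2%N) && (13 <= N), (n == 3%N) && (17 <= N) |
      (4 <= n < 25) && (297 * n + 900 <= 100 * N)]%N ->
  ~~ (N * (N - 1) * (N - 2) <= 3 * n * maxn (32 * (N - 7) + 70) (N * (N - 2)))%N.
Proof.
move=> hn; have nN : (3 * n + 1 < N)%N by lia.
have N8 : (8 <= N)%N by lia.
rewrite -ltnNge maxnMr gtn_max; apply/andP; split; last first.
  rewrite mulnA [(3 * n * N)%N]mulnC -!mulnA ltn_pmul2l; last by lia.
  by rewrite mulnA ltn_pmul2r; lia.
have [M def_N] : exists M, N = (M + 8)%N by exists (N - 8)%N; lia.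
subst N; have -> : (M + 8 - 1 = M + 7)%N by lia.
have -> : (M + 8 - 2 = M + 6)%N by lia.
have -> : (M + 8 - 7 = M + 1)%N by lia.
case/or4P: hn => [/andP[/eqP-> hM]|/andP[/eqP-> hM]|/andP[/eqP-> hM]|/andP[_ hM]].
- by nia.
- by nia.
- by nia.
- by nia.
Qed.

(** * The root [lambda0] and the final bound *)

Section Bound.
Variable R : realType.

Lemma lambda_fun_shift (h : R) :
  lambda_fun (1 + h) = (h ^+ 3 + 3 * h - 2) ^+ 2 - 72 * h ^+ 2 + 72 * h ^+ 4.
Proof. by rewrite /lambda_fun; ring. Qed.

(** With [A = a^3 + 3 a - 2] and [B] likewise, the difference is [b - a] times a
    sum of products of positive factors. *)
Lemma lambda_fun_increasing (a b : R) : 97 / 100 <= a -> a < b ->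
  lambda_fun (1 + a) < lambda_fun (1 + b).
Proof.
move=> ha ab; rewrite !lambda_fun_shift -subr_gt0.
pose A := a ^+ 3 + 3 * a - 2; pose B := b ^+ 3 + 3 * b - 2.
have -> : (b ^+ 3 + 3 * b - 2) ^+ 2 - 72 * b ^+ 2 + 72 * b ^+ 4 -
    ((a ^+ 3 + 3 * a - 2) ^+ 2 - 72 * a ^+ 2 + 72 * a ^+ 4) =
    (b - a) * ((b ^+ 2 + a * b + a ^+ 2 + 3) * (A + B) +
               72 * (a + b) * (a ^+ 2 + b ^+ 2 - 1)) by rewrite /A /B; ring.
have a2 : 9 / 10 <= a ^+ 2 by nra.
have b2 : 9 / 10 <= b ^+ 2 by nra.
have A0 : 0 < A.
  have : 0 <= a * a ^+ 2 by rewrite mulr_ge0 //; lra.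
  by rewrite /A exprS; lra.
have B0 : 0 < B.
  have : 0 <= b * b ^+ 2 by rewrite mulr_ge0 //; lra.
  by rewrite /B exprS; lra.
apply: mulr_gt0; first by lra.
apply: addr_gt0; apply: mulr_gt0; try lra.
have : 0 <= a * b by apply: mulr_ge0; lra.
lra.
Qed.

Lemma lambda0_ex : exists lambda0 : R, is_lambda0 lambda0 /\
  197 / 10 ^+ 2 + 466 / 10 ^+ 5 <= lambda0 < 197 / 10 ^+ 2 + 467 / 10 ^+ 5.
Proof.
pose p : {poly R} := ('X ^+ 3 - 3%:P * 'X ^+ 2 + 6%:P * 'X - 6%:P) ^+ 2
  - 72%:P * 'X * (2%:P - 'X) * ('X - 1) ^+ 2.
have pE g : p.[g] = lambda_fun g by rewrite /p /lambda_fun !hornerE.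
pose a : R := 197 / 10 ^+ 2 + 466 / 10 ^+ 5; pose b : R := 197 / 10 ^+ 2 + 467 / 10 ^+ 5.
have fb : 0 < lambda_fun b by rewrite /lambda_fun /b; lra.
have [||l lab] := @poly_ivt _ p a b.
- by rewrite /a /b; lra.
- by rewrite !pE (ltW fb) andbT /lambda_fun /a; lra.
rewrite /root pE => /eqP fl.
have [al lb] : a <= l /\ l < b.
  case/andP: lab => al; rewrite le_eqVlt => /orP[/eqP lb|lb]; split=> //.
  by exfalso; move: fb; rewrite -lb fl ltxx.
exists l; split; last by apply/andP; split; [exact: al | exact: lb].
have l97 : 97 / 100 <= l - 1 by move: al; rewrite /a; lra.
split=> // [|g /andP[lg _]]; first by move: lb; rewrite /b; lra.
have lg1 : l - 1 < g - 1 by lra.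
by have := lambda_fun_increasing l97 lg1; rewrite ![1 + _]addrC !subrK fl.
Qed.

Lemma is_lambda0_inj (l l' : R) : is_lambda0 l -> is_lambda0 l' -> l = l'.
Proof.
move=> [l2 fl pl] [l'2 fl' pl']; case: (ltgtP l l') => // ll'.
  by have := pl l'; rewrite ll' l'2 fl' ltxx => /(_ isT).
by have := pl' l; rewrite ll' l2 fl ltxx => /(_ isT).
Qed.

Lemma not_arrow_bound (n N : nat) (l : R) : (0 < n)%N -> ~~ ramsey_arrow n N ->
  197 / 100 <= l -> N%:R + 1 <= l * n%:R + 7 * Num.sqrt n%:R.
Proof.
move=> n_gt0 notN l_ge; rewrite leNgt; apply/negP => big_N.
set x := Num.sqrt n%:R in big_N.
have n0 : 0 <= n%:R :> R by rewrite ler0n.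
have x0 : 0 <= x by rewrite sqrtr_ge0.
have x2 : x * x = n%:R by rewrite -expr2 sqr_sqrtr.
have big_N' : 197 / 100 * n%:R + 7 * x < N%:R + 1.
  by apply: le_lt_trans big_N; rewrite lerD2r ler_wpM2r.
have [n25|n25] := leqP 25 n.
  have : (25%:R <= n%:R :> R) by rewrite ler_nat.
  move=> n25'; have x5 : 5 <= x by nra.
  have : (197 * n + 3400 < 100 * N)%N.
    by rewrite -(ltr_nat R) natrD !natrM; lra.
  move=> hN; have := oriented_bound_fails n25 (ltnW hN); rewrite not_arrow_oriented //; lia.
have hN : [|| (n == 1%N) && (8 <= N), (n == 2%N) && (13 <= N), (n == 3%N) && (17 <= N) |
      (4 <= n < 25) && (297 * n + 900 <= 100 * N)]%N.
  have [n4|n4] := leqP 4 n.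
    have n4' : (4%:R <= n%:R :> R) by rewrite ler_nat.
    have n25' : (n%:R <= 25%:R :> R) by rewrite ler_nat ltnW.
    have x_ge2 : 2 <= x by nra.
    have x_le5 : x <= 5 by nra.
    (* Between its values at 4 and 25, the square root is above its chord. *)
    have : 0 <= (x - 2) * (5 - x) by apply: mulr_ge0; lra.
    move=> chord; have : (297 * n + 900 < 100 * N)%N.
      by rewrite -(ltr_nat R) natrD !natrM; lra.
    by move=> /ltnW ->; rewrite n25 !orbT.
  have [n1|[n2|n3]] : n = 1%N \/ n = 2%N \/ n = 3%N by lia.
  - subst n; have x1 : 1 <= x by nra.
    by have -> : (8 <= N)%N by rewrite -ltnS -(ltr_nat R) -addn1 natrD; lra.
  - subst n; have x1 : 141 / 100 <= x by nra.
    by have -> : (13 <= N)%N by rewrite -ltnS -(ltr_nat R) -addn1 natrD; lra.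
  - subst n; have x1 : 17 / 10 <= x by nra.
    by have -> : (17 <= N)%N by rewrite -ltnS -(ltr_nat R) -addn1 natrD; lra.
have := size_bound_fails hN; rewrite not_arrow_card //; lia.
Qed.

End Bound.

Theorem theorem1 (R : realType) :
  exists lambda0 : R,
    [/\ unique (@is_lambda0 R) lambda0,
        197 / 10 ^+ 2 + 466 / 10 ^+ 5 <= lambda0
          < 197 / 10 ^+ 2 + 467 / 10 ^+ 5 &
        forall n : nat, (0 < n)%N ->
          (ramsey_path3_3 n)%:R <= lambda0 * n%:R + 7 * Num.sqrt n%:R].
Proof.
have [l [l0 lab]] := lambda0_ex R; exists l; split=> // [|n n_gt0].
  by split=> // l'; exact: is_lambda0_inj.
have l_ge : 197 / 100 <= l by case/andP: lab => + _; lra.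
rewrite /ramsey_path3_3; case: ex_minnP => -[|N] _ minN.
  by rewrite addr_ge0 // mulr_ge0 ?ler0n ?sqrtr_ge0 //; lra.
rewrite -[in X in X <= _]addn1 natrD; apply: not_arrow_bound => //.
by apply/negP => /minN; rewrite ltnn.
Qed.
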